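(* Let $G$ be a finite $Cpo$-group. Then $G$ is one of the following groups: (1) $|G|=p$, where $p$ is a prime number; (2) $|G|=pq$, where $p$ and $q$ are distinct primes, and $F(G)=G'$, $|F(G)|=p$, such that $p>q$ and $q\mid p-1$.
   Context: A finite group $G$ is called a $Cpo$-group if the order of the centralizer $C_G(x)=\{g\in G \mid gx=xg\}$ of every non-trivial element $x\in G$ is prime. $F(G)$ denotes the Fitting subgroup of $G$ and $G'$ its derived subgroup.
   Formalization: The group G is additionally assumed non-trivial, since the trivial group is vacuously a Cpo-group but has order 1 and so belongs to neither (1) nor (2). *)

(* Defs.v *)
From mathcomp Require Import all_boot all_order all_fingroup all_solvable.

Set Implicit Arguments.
Unset Strict Implicit.
Unset Printing Implicit Defensive.

Local Open Scope group_scope.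

(* The trivial group satisfies this vacuously. *)
Definition Cpo_group (gT : finGroupType) (G : {group gT}) : Prop :=
  forall x : gT, x \in G -> x != 1 -> prime #|'C_G[x]|.

(* Main.v *)
(* A nontrivial nilpotent subgroup lies in the centralizer of any nontrivial
   element of its center, so it has prime order and is self-centralizing.
   Solvability is by induction on the order: if p is the least prime divisor
   of #|G|, a Sylow p-subgroup S has order p, and 'N_G(S) / S embeds in Aut S,
   of order p - 1, so S = 'N_G(S) by minimality of p; transfer into S then shows
   that G^`(1) is a proper subgroup. Hence F = 'F(G) is nontrivial, of prime
   order and self-centralizing, and G / F embeds in the cyclic group Aut F; its
   order is prime because every nontrivial element of G has prime order. *)
Require Import Defs.
From mathcomp Require Import all_boot all_order all_fingroup all_solvable.
From mathcomp Require Import ssralg finalg.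

Set Implicit Arguments.
Unset Strict Implicit.
Unset Printing Implicit Defensive.

Import FiniteModule.

Local Open Scope group_scope.

(* The transfer of [g \in S^#] into [S] is a sum of elements of [S] that are
   [G]-conjugate to powers of [g]; as [S] is its own normalizer and meets its
   other conjugates trivially, only the coset [S] itself contributes, and it
   contributes [g]. So the transfer, which kills the derived group, does not
   kill [g]. *)
Lemma self_normalizing_prime_der1 (gT : finGroupType) (G S : {group gT}) :
  S \subset G -> prime #|S| -> 'N_G(S) = S -> ~~ (S \subset G^`(1)).
Proof.
move=> sSG prS defN; apply/negP=> sSG'.
have ntS: S :!=: 1 by rewrite -cardG_gt1 prime_gt1.
have cSS: abelian S by apply/cyclic_abelian/prime_cyclic.
have [g Sg ntg] := trivgPn _ ntS.
have Gg := subsetP sSG g Sg.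
have genS y : y \in S -> y != 1 -> S :=: <[y]>.
  by move=> Sy nty; apply: nt_gen_prime; rewrite ?inE ?nty.
have abA: abelian (idm_morphism S @* S) by rewrite morphim_idm.
pose V := transfer_morphism G (alpha := idm_morphism S) abA.
have V1 : V g = 1.
  have: V g \in (V @* G)^`(1).
    by rewrite -morphim_der // mem_morphim ?(subsetP sSG').
  by rewrite (derG1P (FinRing.zmod_abelian _)) inE => /eqP.
have partX := rcosets_cycle_partition sSG Gg.
set X := transversal (rcosets S G :* <[g]>) G.
have trX : is_transversal X (rcosets S G :* <[g]>) G by apply: transversalP.
have sXG := subsetP (transversal_sub trX).
have SgS : S * <[g]> = S by rewrite mulGSid // cycle_subG.
(* [S] absorbs [<[g]>], so it is itself one of the double cosets that [X] represents; [x0] is its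
   representative. *)
have: (S : {set gT}) \in rcosets S G :* <[g]>.
  apply/imset2P; exists (S : {set gT}) <[g]>; rewrite ?inE //.
  by apply/rcosetsP; exists 1; rewrite ?rcoset1.
case/and3P: (trX) => _ _ /forall_inP trX1 /trX1/cards1P[x0 defx0].
have [Xx0 Sx0] : x0 \in X /\ x0 \in S by apply/setIP; rewrite defx0 inE.
have := transfer_cycle_expansion sSG (alpha := idm_morphism S) abA Gg trX.
rewrite -[LHS]/(V g) V1 (bigD1 x0) //= rcoset_id // big1.
  have ->: #|<[g]> : S| = 1%N by rewrite (genS g) // indexgg.
  rewrite expg1 /conjg invgK mulgA (centsP cSS x0 Sx0 g Sg) mulgK GRing.addr0.
  have Ag : g \in idm_morphism S @* S by rewrite morphim_idm.
  move/esym/eqP; rewrite [_ == _](morph_injm_eq1 (injm_fmod abA)) //.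
  by rewrite (negPf ntg).
(* Any other [x] contributes [y], a conjugate of a power of [g]. If [y != 1], both [y] and [y ^ x]
   generate [S], so [x] normalizes [S], hence lies in [S] and equals [x0]. *)
move=> x /andP[Xx x0x].
set n := #|_ : _|; set y := (g ^+ n) ^ x^-1.
have Sy : y \in S.
  by rewrite /y conjgE invgK mulgA -mem_rcoset mulg_exp_card_rcosets.
have [-> | nty] := eqVneq y 1; first by rewrite morph1.
case/eqP: x0x; apply/set1P; rewrite -defx0 inE Xx -defN inE sXG //=.
apply/normP; rewrite [in LHS](genS y) // -cycleJ -genS //.
  by rewrite conjgKV groupX.
by rewrite conjg_eq1.
Qed.

Lemma index_cent_dvd_Aut (gT : finGroupType) (A S : {group gT}) :
  A \subset 'N(S) -> #|A : 'C_A(S)| %| #|Aut S|.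
Proof.
move=> nSA; have := card_morphim (conj_aut S) A.
rewrite ker_conj_aut (setIidPr nSA) indexgI => <-.
exact/cardSg/Aut_conj_aut.
Qed.

(** The group ['C_G[x]] has prime order and shares [x != 1] with [H], so it lies in [H]. *)
Lemma Cpo_groupS (gT : finGroupType) (G H : {group gT}) :
  H \subset G -> Cpo_group G -> Cpo_group H.
Proof.
move=> sHG cpoG x Hx ntx; have prC := cpoG x (subsetP sHG x Hx) ntx.
have [sCH | tiCH] := prime_subgroupVti H prC.
  suff ->: 'C_H[x] = 'C_G[x] by [].
  by apply/eqP; rewrite eqEsubset setSI // subsetI sCH subsetIr.
have : x \in H :&: 'C_G[x] by rewrite !in_setI Hx (subsetP sHG) // cent1id.
by rewrite tiCH inE (negPf ntx).
Qed.

Lemma Cpo_nil_prime (gT : finGroupType) (G : {group gT}) :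
  Cpo_group G -> nilpotent G -> G :!=: 1 -> prime #|G|.
Proof.
move=> cpoG nilG ntG.
have [z /setIP[Gz cGz] ntz] : exists2 z, z \in 'Z(G) & z != 1.
  by apply/trivgPn; rewrite center_nil_eq1.
by rewrite -(setIidPl (_ : G \subset 'C[z])) ?cpoG // sub_cent1.
Qed.

Lemma Cpo_nil_self_cent (gT : finGroupType) (G H : {group gT}) :
    Cpo_group G -> H \subset G -> nilpotent H -> H :!=: 1 ->
  'C_G(H) = H.
Proof.
move=> cpoG sHG nilH ntH.
have prH := Cpo_nil_prime (Cpo_groupS sHG cpoG) nilH ntH.
have cHH : abelian H by apply/cyclic_abelian/prime_cyclic.
have [h Hh nth] := trivgPn _ ntH.
have prC := cpoG h (subsetP sHG h Hh) nth.
have defH : H :=: <[h]> by apply: nt_gen_prime; rewrite ?inE ?nth.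
rewrite {1}defH cent_cycle; apply/esym/eqP; rewrite eqEcard.
have sHC : H \subset 'C_G[h] by rewrite subsetI sHG -cent_cycle -defH.
rewrite sHC; have := cardSg sHC.
by rewrite dvdn_prime2 // => /eqP->; rewrite leqnn.
Qed.

Lemma Cpo_sol (gT : finGroupType) (G : {group gT}) :
  Cpo_group G -> solvable G.
Proof.
have [n] := ubnP #|G|; elim: n G => // n IHn G /ltnSE leGn cpoG.
have [-> | ntG] := eqVneq G 1%G; first exact: solvable1.
set p := pdiv #|G|.
have pr_p : prime p by rewrite pdiv_prime // cardG_gt1.
have [S sylS] := Sylow_exists p G.
have [sSG pS _] := and3P sylS.
have nilS := pgroup_nil pS.
have ntS : S :!=: 1.
  rewrite -cardG_gt1 (card_Hall sylS) p_part_gt1.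
  by rewrite mem_primes pr_p cardG_gt0 pdiv_dvd.
have prS := Cpo_nil_prime (Cpo_groupS sSG cpoG) nilS ntS.
have oS : #|S| = p.
  by apply/eqP; move: pS; rewrite /pgroup pnatE // inE.
have cNS : 'C_('N_G(S))(S) = S.
  apply: Cpo_nil_self_cent => //; first exact: Cpo_groupS (subsetIl _ _) cpoG.
  by rewrite subsetI sSG normG.
have defN : 'N_G(S) = S.
  have := index_cent_dvd_Aut (subsetIr G 'N(S)).
  rewrite cNS card_Aut_cyclic ?prime_cyclic // oS totient_prime // => dvNp.
  apply/eqP; rewrite eqEsubset subsetI sSG normG !andbT -indexg_eq1.
  have d_gt0 := indexg_gt0 'N_G(S) S.
  (* An index other than 1 divides [#|G|], so it is at least [p], the least prime divisor, and
     cannot divide [p - 1]. *)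
  apply: contraLR dvNp => ntN; rewrite gtnNdvd ?ltn_predRL ?prime_gt1 //.
  rewrite prednK ?prime_gt0 // pdiv_min_dvd //.
    by rewrite ltn_neqAle eq_sym ntN.
  exact: dvdn_trans (dvdn_indexg _ _) (cardSg (subsetIl _ _)).
have sG'G : G^`(1) \proper G.
  rewrite properE der_sub /=.
  apply: contra (self_normalizing_prime_der1 sSG prS defN).
  exact: subset_trans.
rewrite (series_sol (der_normal 1 G)) (abelian_sol (der_abelian 0 G)) andbT.
apply: IHn; last exact: Cpo_groupS (proper_sub sG'G) cpoG.
exact: leq_trans (proper_card sG'G) leGn.
Qed.

Theorem theorem2p7 (gT : finGroupType) (G : {group gT})
    (ntG : G :!=: 1) (cpoG : Cpo_group G) :
  (exists p : nat, prime p /\ #|G| = p)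
  \/
  (exists p q : nat,
     [/\ prime p, prime q & p != q] /\
     [/\ #|G| = (p * q)%N, 'F(G) = G^`(1), #|'F(G)| = p,
         (q < p)%N & (q %| p - 1)%N]).
Proof.
have [nilG | not_nilG] := boolP (nilpotent G).
  by left; exists #|G|; split; first exact: Cpo_nil_prime.
right; set F := 'F(G)%G.
have [sFG nFG] := andP (Fitting_normal G).
have ntF : F :!=: 1 by rewrite trivg_Fitting ?Cpo_sol.
have defC : 'C_G(F) = F := Cpo_nil_self_cent cpoG sFG (Fitting_nil G) ntF.
have prF := Cpo_nil_prime (Cpo_groupS sFG cpoG) (Fitting_nil G) ntF.
have cycGF : cyclic (G / F).
  suff: cyclic (G / 'ker_G (conj_aut F)) by rewrite ker_conj_aut defC.
  rewrite (isog_cyclic (first_isog_loc _ nFG)).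
  exact: cyclicS (Aut_conj_aut _ _) (Aut_prime_cyclic prF).
have sG'F : G^`(1) \subset F by rewrite der1_min // cyclic_abelian.
have ltFG : F \proper G.
  rewrite properEneq sFG andbT; apply: contra not_nilG => /eqP <-.
  exact: Fitting_nil.
have prGF : prime #|G : F|.
  (* A generator of [G / F] lifts to some [x] of prime order; its own order divides [#[x]] and is
     not 1. *)
  have [/= Fx defGF] := cyclicP cycGF.
  have /morphimP[/= x Nx Gx def_Fx] : Fx \in G / F by rewrite defGF cycle_id.
  have ntFx : Fx != 1.
    by rewrite -cycle_eq1 -defGF -subG1 quotient_sub1 // proper_subn.
  have ntx : x != 1 by apply: contraNneq ntFx => x1; rewrite def_Fx x1 morph1.
  have prx : prime #[x].
    apply: (Cpo_nil_prime (Cpo_groupS _ cpoG)); rewrite ?cycle_subG ?cycle_eq1 //.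
    exact/abelian_nil/cycle_abelian.
  rewrite -card_quotient // defGF -orderE.
  have := morph_order (coset_morphism F) Nx; rewrite /= -def_Fx.
  have /primeP[_ dv_x] := prx; move/dv_x.
  by rewrite order_eq1 (negPf ntFx) => /eqP->.
have dvGF : #|G : F| %| #|F|.-1.
  rewrite -totient_prime // -card_Aut_cyclic ?prime_cyclic // -{1}defC.
  exact: index_cent_dvd_Aut.
have p1_gt0 : 0 < #|F|.-1 by rewrite -ltnS prednK ?prime_gt1 ?prime_gt0.
have ltqp : #|G : F| < #|F|.
  by rewrite -(prednK (prime_gt0 prF)) ltnS dvdn_leq.
exists #|F|, #|G : F|; split; split=> //.
- by rewrite eq_sym neq_ltn ltqp.
- by rewrite Lagrange.
(* If [F] is not inside the derived group, they meet trivially since [#|F|] is prime; the derived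
   group, being inside [F], is then trivial and [G] is abelian. *)
- have [sFG' | tiG'F] := prime_subgroupVti G^`(1) prF.
    by apply/eqP; rewrite eqEsubset sFG'.
  case/negP: not_nilG; apply/abelian_nil/derG1P.
  by rewrite -(setIidPl sG'F).
- by rewrite subn1.
Qed.
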